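(* Let $|\mathcal{S}|$, $c(\mathcal{S})$, $r(\mathcal{S})$, $b(\mathcal{S})$ denote, respectively, the number of arcs, the number of crossings, the number of pairs consisting of an arc and another arc lying entirely to its right, and the total number of fixed points under arcs, of the link pattern $P_{\mathcal{S}}$ (precise definitions in the context). Let $\sigma=\sigma_{\mathcal{S}}$ be the product of the reflections $s_\beta$, $\beta\in\mathcal{S}$. (1) For a strongly orthogonal (i.e. pairwise disjoint) set of positive roots $\mathcal{S}=\{e_{j_s}-e_{i_s}\}_{s=1}^k$ in $\mathfrak{sl}_n$, the length of $\sigma$ in $S_n$ is $$\ell(\sigma)=2|\mathcal{S}|^2-|\mathcal{S}|+2b(\mathcal{S})-4r(\mathcal{S})-2c(\mathcal{S}).$$ (2) For a strongly orthogonal (i.e. pairwise disjoint) set of positive roots $\mathcal{S}=\{e_{j_s}-e_{i_s}\}_{s=1}^a\cup\{2e_{k_s}\}_{s=1}^{d}\cup\{e_{m_s}+e_{l_s}\}_{s=1}^f$ in $C_n$, the length of $\sigma$ in $W_{C_n}$ is $$\ell(\sigma)=|\mathcal{S}|^2-a+b(\mathcal{S})-c(\mathcal{S})-2r(\mathcal{S}).$$ (3) For a pairwise disjoint set $\mathcal{S}=\{e_{j_s}-e_{i_s}\}_{s=1}^a\cup\{e_{k_s}\}_{s=1}^{2d}\cup\{e_{m_s}+e_{l_s}\}_{s=1}^f$ (so that $\sigma\in W_{D_n}$), the length of $\sigma$ in $W_{D_n}$ is $$\ell(\sigma)=|\mathcal{S}|^2-|\mathcal{S}|+a+b(\mathc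al{S})-c(\mathcal{S})-2r(\mathcal{S}).$$
   Context: Root systems. For $\mathfrak{sl}_n$: $R^+=\{e_j-e_i\}_{1\le i<j\le n}$. For $C_n$: $R^+=\{e_j\pm e_i\}_{1\le i<j\le n}\cup\{2e_i\}_{i=1}^n$. For $B_n$: $R^+=\{e_j\pm e_i\}_{1\le i<j\le n}\cup\{e_i\}_{i=1}^n$. For $D_n$: $R^+=\{e_j\pm e_i\}_{1\le i<j\le n}$. In each case $R=R^+\cup(-R^+)$. In the notation $e_j-e_i$, $e_j+e_i$ for elements of $\mathcal{S}$ one has $i<j$. A set $\mathcal{S}\subset R^+$ is strongly orthogonal if $\alpha\pm\beta\notin R$ for all distinct $\alpha,\beta\in\mathcal{S}$. Two roots are disjoint if the sets of indices of the $e_i$'s occurring in them are disjoint; in $\mathfrak{sl}_n$ and $C_n$ a set is strongly orthogonal iff its elements are pairwise disjoint. Weyl groups. $S_n$ acts by $w(e_i)=e_{w(i)}$. $W_{C_n}=W_{B_n}$ is the group of bijections $w$ of $\{-n,\dots,-1,1,\dots,n\}$ with $w(-i)=-w(i)$, acting by $w(e_i)=\mathrm{sign}(w(i))e_{|w(i)|}$; $W_{D_n}$ is its subgroup of maps sending an even number of positive numbers to negative numbers. $s_\beta$ is the reflection in $\beta$ ($s_{e_k}=s_{2e_k}$), and $\sigma_{\mathcal{S}}=\prod_{\beta\in\mathcal{S}}s_\beta$. The length of $w$ is $\ell(w)=\#\{\beta\in R^+ : w(\beta)\in -R^+\}$, where $R^+$ is the set of positive roots of the relevant type ($\mathfrak{sl}_n$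 in (1), $C_n$ in (2), $D_n$ in (3)). Link patterns. A link pattern is a graph on linearly ordered vertices (drawn on a horizontal line) whose edges, called arcs, are pairwise disjoint, i.e. have no common end points; a vertex that is not an end point of any arc is a fixed point. For $\mathcal{S}=\{e_{j_s}-e_{i_s}\}_{s=1}^k$ in $\mathfrak{sl}_n$, $P_{\mathcal{S}}$ is the link pattern on vertices $1,\dots,n$ with arcs $(i_s,j_s)$. For $\mathcal{S}$ as in (2) or (3), $P_{\mathcal{S}}$ is the link pattern on the vertices $-n<\dots<-1<1<\dots<n$ in which each $2e_k$ (or $e_k$) gives one arc $(-k,k)$, each $e_j-e_i$ ($0<i<j$) gives two arcs joining $i$ with $j$ and $-i$ with $-j$, and each $e_j+e_i$ ($0<i<j$) gives two arcs joining $-i$ with $j$ and $i$ with $-j$. Let $|\mathcal{S}|=m$ be the number of arcs of $P_{\mathcal{S}}$ (not the number of roots in $\mathcal{S}$), and write the arcs as $(a_1,b_1),\dots,(a_m,b_m)$ with $a_i<b_i$. Define - $c(\mathcal{S})=\sum_{s=1}^m \#\{t : a_t<a_s<b_t<b_s\}$; - $r(\mathcal{S})=\sum_{s=1}^m \#\{t : a_t>b_s\}$; - $b(\mathcal{S})=\sum_{s=1}^m \#\{p \text{ a vertex} : a_s<p<b_s,\ p\notin\{a_t,b_t\}_{t=1}^m\}$. *)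

(* Defs.v *)
From HB Require Import structures.
From mathcomp Require Import all_boot all_order all_fingroup all_algebra.
From mathcomp Require Import finmap.

Set Implicit Arguments.
Unset Strict Implicit.
Unset Printing Implicit Defensive.

Import Order.TTheory GRing.Theory Num.Theory.
Local Open Scope fset_scope.
Local Open Scope ring_scope.

(* The index i : 'I_n stands for the integer i + 1 in {1, ..., n}. *)

Notation vec n := 'rV[rat]_n.

Definition evec n (i : 'I_n) : vec n := delta_mx 0 i.

Definition difference_roots n : {fset vec n} :=
  [fset evec p.2 - evec p.1 | p : 'I_n * 'I_n & (p.1 < p.2)%N].

Definition sum_roots n : {fset vec n} :=
  [fset evec p.2 + evec p.1 | p : 'I_n * 'I_n & (p.1 < p.2)%N].

Definition short_roots n : {fset vec n} := [fset evec i | i : 'I_n].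

Definition long_roots n : {fset vec n} := [fset 2 *: evec i | i : 'I_n].

Definition posA n : {fset vec n} := difference_roots n.
Definition posD n : {fset vec n} := difference_roots n `|` sum_roots n.
Definition posB n : {fset vec n} := posD n `|` short_roots n.
Definition posC n : {fset vec n} := posD n `|` long_roots n.

Definition roots_of n (pos : {fset vec n}) : {fset vec n} :=
  pos `|` [fset - x | x in pos].

Definition strongly_orthogonal n (pos S : {fset vec n}) : Prop :=
  forall x y : vec n, x \in S -> y \in S -> x != y ->
    (x + y \notin roots_of pos) /\ (x - y \notin roots_of pos).

Definition indices n (x : vec n) : {set 'I_n} := [set i | x 0 i != 0].

Definition pairwise_disjoint n (S : {fset vec n}) : Prop :=
  forall x y : vec n, x \in S -> y \in S -> x != y ->
    indices x :&: indices y = set0.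

(* Linear maps are matrices acting on row vectors on the right, so that
   x *m reflection b = x - 2 (x, b) / (b, b) b. *)
Definition inner n (x y : vec n) : rat := (x *m y^T) 0 0.

Definition reflection n (b : vec n) : 'M[rat]_n :=
  1%:M - (2 / inner b b) *: (b^T *m b).

(* The factors are taken in the enumeration order of S; reflections in
   pairwise disjoint vectors commute, so this order is irrelevant there. *)
Definition sigma n (S : {fset vec n}) : 'M[rat]_n :=
  \big[mulmx/1%:M]_(b <- S) reflection b.

Definition weyl_length n (pos : {fset vec n}) (w : 'M[rat]_n) : nat :=
  #|` [fset b in pos | - (b *m w) \in pos]|.

(* (false, i) is the integer i + 1 and (true, i) is -(i + 1). *)
Definition svertex (n : nat) : Type := (bool * 'I_n)%type.

HB.instance Definition _ n := Finite.on (svertex n).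

Definition svpos n (i : 'I_n) : svertex n := (false, i).
Definition svopp n (x : svertex n) : svertex n := (~~ x.1, x.2).
Definition svval n (x : svertex n) : int := (-1) ^+ x.1 * (x.2.+1)%:Z.

Definition svle n : rel (svertex n) := fun x y => svval x <= svval y.

Lemma svval_inj n : injective (@svval n).
Proof.
move=> [[] i] [[] j]; rewrite /svval /= ?expr1 ?expr0 ?mulN1r ?mul1r //.
- by move/oppr_inj=> [] /val_inj ->.
- by move=> [] /val_inj ->.
Qed.

Lemma svle_refl n : reflexive (@svle n).
Proof. by move=> x; rewrite /svle lexx. Qed.

Lemma svle_anti n : antisymmetric (@svle n).
Proof. by move=> x y; rewrite /svle => /le_anti; apply: svval_inj. Qed.

Lemma svle_trans n : transitive (@svle n).
Proof. by move=> y x z; apply: le_trans. Qed.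

Lemma svle_total n : total (@svle n).
Proof. by move=> x y; apply: le_total. Qed.

Fact svertex_display : Order.disp_t. Proof. exact: Order.Disp tt tt. Qed.

HB.instance Definition _ n :=
  Order.Le_isPOrder.Build svertex_display (svertex n)
    (@svle_refl n) (@svle_anti n) (@svle_trans n).
HB.instance Definition _ n :=
  Order.POrder_isTotal.Build svertex_display (svertex n) (@svle_total n).

Lemma lt_svertexE n (x y : svertex n) : (x < y)%O = (svval x < svval y).
Proof. by rewrite !lt_neqAle (inj_eq (@svval_inj n)). Qed.

Definition weylA n (M : 'M[rat]_n) : Prop :=
  exists w : 'S_n, M = \matrix_(i < n) evec (w i).

Definition signed_perm n (w : {perm svertex n}) : Prop :=
  forall x, w (svopp x) = svopp (w x).

Definition signed_mx n (w : {perm svertex n}) : 'M[rat]_n :=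
  \matrix_(i < n) ((-1) ^+ (w (svpos i)).1 *: evec (w (svpos i)).2).

Definition weylC n (M : 'M[rat]_n) : Prop :=
  exists2 w : {perm svertex n}, signed_perm w & M = signed_mx w.

Definition weylD n (M : 'M[rat]_n) : Prop :=
  exists w : {perm svertex n},
    [/\ signed_perm w, ~~ odd #|[set i | (w (svpos i)).1]| & M = signed_mx w].

(* A link pattern on a finite linearly ordered set V of vertices is given by
   its set of arcs (a, b), with a < b. *)
Section LinkPatterns.
Context {d : Order.disp_t} {V : finOrderType d}.
Implicit Type P : {set V * V}.

Definition crossings P : nat :=
  \sum_(s in P) #|[set t in P | (t.1 < s.1)%O && (s.1 < t.2 < s.2)%O]|.

Definition right_pairs P : nat := \sum_(s in P) #|[set t in P | (s.2 < t.1)%O]|.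

Definition fixed_point P (p : V) : bool :=
  [forall t in P, (p != t.1) && (p != t.2)].

Definition fixed_under_arcs P : nat :=
  \sum_(s in P) #|[set p : V | (s.1 < p < s.2)%O && fixed_point P p]|.

End LinkPatterns.

Definition linkA n (S : {fset vec n}) : {set 'I_n * 'I_n} :=
  [set p : 'I_n * 'I_n | (p.1 < p.2)%N & evec p.2 - evec p.1 \in S].

Definition link_signed n (S : {fset vec n}) : {set svertex n * svertex n} :=
  let pos := @svpos n in let neg i := svopp (pos i) in
  ([set (neg k, pos k) | k in [set k : 'I_n |
      (evec k \in S) || (2 *: evec k \in S)]]
   :|: \bigcup_(p : 'I_n * 'I_n |
         (p.1 < p.2)%N && (evec p.2 - evec p.1 \in S))
         [set (pos p.1, pos p.2); (neg p.2, neg p.1)]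
   :|: \bigcup_(p : 'I_n * 'I_n |
         (p.1 < p.2)%N && (evec p.2 + evec p.1 \in S))
         [set (neg p.1, pos p.2); (neg p.2, pos p.1)])%SET.

(* Main.v *)
Require Import Defs.
From mathcomp Require Import all_boot all_order all_fingroup all_algebra.
From mathcomp Require Import finmap.
From mathcomp Require Import zify ring.

Set Implicit Arguments.
Unset Strict Implicit.
Unset Printing Implicit Defensive.

Local Open Scope fset_scope.
Local Open Scope ring_scope.

Import Order.TTheory GRing.Theory Num.Theory.

(** The length of a permutation is its number of inversions, and an involution
    that swaps the end points of the arcs of a link pattern has its inversions
    read off from the pattern ([card_inversions_swaps]): each arc gives one, each
    fixed point under an arc gives two, and each pair of arcs gives four, less
    two if they cross and less four if they lie side by side.  With m arcs this
    is m + 2b + 2m(m - 1) - 2c - 4r, which is the formula in type A.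

    In types C and D every root is a difference of two of the vectors +e_i, -e_i,
    indexed by the signed vertices, so the roots look like those of type A on 2n
    vertices, except that the pairs (u, v) and (-v, -u) represent the same root
    ([pair_root_flip], [pair_root_inj]).  Hence the number I of inversions on the
    signed vertices counts each positive root made negative twice, except that
    the long roots 2 e_i are counted once; as many of these become negative as
    there are indices i with w(i) < 0.  Writing N for that number, the length is
    (I + N) / 2 in type C ([weyl_length_C]), and (I - N) / 2 in type D, which has
    no long roots ([weyl_length_D]).  Finally N is the number of arcs that join a
    negative to a positive vertex ([card_negated]), and the other arcs are the 2a
    arcs of the roots e_j - e_i ([card_noncrossing]), so N = m - 2a.

    That sigma really swaps the end points of the arcs holds because an arc
    (u, v) comes from a root on the line of the difference of two unit vectors,
    whose reflection exchanges them ([reflection_swap]), while the other factors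
    of sigma fix both ([sigma_swaps]).  Strong orthogonality enters only through
    disjointness ([strongly_orthogonal_disjointA],
    [strongly_orthogonal_disjointC]), and in type D the number N is even because
    the number of short roots is ([odd_crossing_zero]). *)

(** * Inversions of the swap along a link pattern *)

Section Inversions.
Context {d : Order.disp_t} {V : finOrderType d}.
Implicit Types (P : {set V * V}) (w : V -> V).

(** The second clause says that an arc is determined by either of its end points. *)
Definition link_pattern P : Prop :=
  (forall s, s \in P -> (s.1 < s.2)%O) /\
  (forall s t v, s \in P -> t \in P ->
     v \in [:: s.1; s.2] -> v \in [:: t.1; t.2] -> s = t).

Definition swaps P w : Prop :=
  (forall s, s \in P -> w s.1 = s.2 /\ w s.2 = s.1) /\
  (forall v, fixed_point P v -> w v = v).

Definition inversions w : {set V * V} :=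
  [set x | (x.1 < x.2)%O & (w x.2 < w x.1)%O].

(** Counting the elements below a vertex embeds the vertices in order into the
    natural numbers; comparisons of end points then become linear arithmetic. *)
Lemma nat_order_embedding :
  exists h : V -> nat, forall x y, (x < y)%O = (h x < h y)%N.
Proof.
have mono x y : (x < y)%O -> (#|[set u | u < x]%O| < #|[set u | u < y]%O|)%N.
  move=> xy; apply/proper_card/properP; split.
    by apply/subsetP => u; rewrite !inE => /lt_trans; apply.
  by exists x; rewrite !inE ?ltxx.
exists (fun v => #|[set u | u < v]%O|) => x y.
case: (ltgtP x y) => [/mono->//|/mono|->]; last by rewrite ltnn.
by move/ltnW; rewrite leqNgt => /negPf->.
Qed.

(** Every vertex is fixed or is an end point of exactly one arc, so a sum over
    the vertices is a sum over the arcs plus a sum over the fixed points. *)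
Lemma sum_vertices P (f : V -> nat) : link_pattern P ->
  (\sum_v f v = \sum_(s in P) (f s.1 + f s.2) + \sum_(p | fixed_point P p) f p)%N.
Proof.
move=> [ltP disP].
(* The indicators of the possible positions of a vertex sum to one. *)
have cover v : (fixed_point P v + \sum_(s in P) ((v == s.1) + (v == s.2)) = 1)%N.
  case: (boolP (fixed_point P v)) => [/forallP fixv|].
    rewrite big1 // => s sP; have /implyP/(_ sP)/andP[] := fixv s.
    by move=> /negPf-> /negPf->.
  rewrite negb_forall => /existsP[s]; rewrite negb_imply => /andP[sP].
  rewrite negb_and !negbK => vs; have {}vs : v \in [:: s.1; s.2] by rewrite !inE.
  rewrite (bigD1 s) //= big1 => [|t /andP[tP nts]].
    move: vs; rewrite !inE; have := ltP s sP.
    by case: eqP => [->|_] /=; case: eqP => // ->; rewrite ?ltxx.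
  case: (boolP (v \in [:: t.1; t.2])) => [vt|].
    by rewrite (disP t s v tP sP vt vs) eqxx in nts.
  by rewrite !inE negb_or => /andP[/negPf-> /negPf->].
transitivity (\sum_v (fixed_point P v * f v +
    \sum_(s in P) ((v == s.1) * f v + (v == s.2) * f v)))%N.
  apply: eq_bigr => v _; rewrite -[LHS]mul1n -(cover v) mulnDl; congr addn.
  by rewrite big_distrl /=; apply: eq_bigr => s _; rewrite mulnDl.
have pick (a : V) : (\sum_v (v == a) * f v = f a)%N.
  rewrite (bigD1 a) //= eqxx mul1n big1 ?addn0 // => v /negPf->.
  by rewrite mul0n.
rewrite big_split [LHS]addnC /=; congr addn.
  rewrite exchange_big /=; apply: eq_bigr => s _.
  by rewrite big_split /= !pick.
rewrite [RHS]big_mkcond; apply: eq_bigr => v _.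
by case: ifP; rewrite ?mul1n.
Qed.

(** Splitting both vertices of a possible inversion by [sum_vertices] leaves
    three kinds of pairs.  Two fixed points are never inverted.  A fixed point
    and an arc give two inversions if the point lies under the arc and none
    otherwise.  An arc gives one inversion by itself, and two distinct arcs give
    4, 2 or 0 inversions when they are nested, crossing or side by side. *)
Lemma card_inversions_swaps P w : link_pattern P -> swaps P w ->
  (#|inversions w| + #|P| + 4 * right_pairs P + 2 * crossings P
   = 2 * #|P| ^ 2 + 2 * fixed_under_arcs P)%N.
Proof.
move=> linkP [swP fixP]; have [ltP disP] := linkP.
pose inv (x y : V) : nat := (x < y)%O && (w y < w x)%O.
have -> : #|inversions w| = (\sum_x \sum_y inv x y)%N.
  rewrite pair_bigA -sum1_card big_mkcond /=; apply: eq_bigr => x _.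
  by rewrite inE /inv; case: ifP.
pose R (s t : V * V) : nat := (s.2 < t.1)%O.
pose C (s t : V * V) : nat := (t.1 < s.1)%O && (s.1 < t.2 < s.2)%O.
have cardE (T : finType) (A : {pred T}) (Q : pred T) :
    #|[set t in A | Q t]| = (\sum_(t in A) Q t)%N.
  rewrite -sum1dep_card big_mkcondr; apply: eq_bigr => t _; by case: (Q t).
have -> : right_pairs P = (\sum_(s in P) \sum_(t in P) R s t)%N.
  by apply: eq_bigr => s _; rewrite cardE.
have -> : crossings P = (\sum_(s in P) \sum_(t in P) C s t)%N.
  by apply: eq_bigr => s _; rewrite cardE.
have -> : fixed_under_arcs P =
    (\sum_(s in P) \sum_(p | fixed_point P p) (s.1 < p < s.2)%O)%N.
  apply: eq_bigr => s _; rewrite -sum1dep_card big_mkcond [RHS]big_mkcond.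
  by apply: eq_bigr => p _; case: (fixed_point P p); case: (s.1 < p < s.2)%O.
(* The inversions between an end point of s and an end point of t, in this order. *)
pose G (s t : V * V) := (inv s.1 t.1 + inv s.1 t.2 + (inv s.2 t.1 + inv s.2 t.2))%N.
have -> : (\sum_x \sum_y inv x y = \sum_(s in P) \sum_(t in P) G s t +
    2 * \sum_(s in P) \sum_(p | fixed_point P p) (s.1 < p < s.2)%O)%N.
  rewrite (sum_vertices _ linkP).
  have -> : (\sum_(p | fixed_point P p) \sum_y inv p y =
      \sum_(s in P) \sum_(p | fixed_point P p) (s.1 < p < s.2)%O)%N.
    rewrite [RHS]exchange_big /=; apply: eq_bigr => p fp.
    rewrite (sum_vertices _ linkP) [X in (_ + X)%N]big1 ?addn0 => [|q fq].
      apply: eq_bigr => s sP; have [w1 w2] := swP s sP.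
      rewrite /inv w1 w2 (fixP p fp); have := ltP s sP.
      by case: (ltgtP p s.1); case: (ltgtP p s.2) => //= p2 p1 s12;
        have := lt_trans s12 (lt_trans p2 p1); rewrite ltxx.
    by rewrite /inv (fixP p fp) (fixP q fq); case: ltgtP.
  rewrite mul2n -addnn addnA; congr addn; rewrite -big_split /=.
  apply: eq_bigr => s sP; rewrite !(sum_vertices _ linkP) addnACA.
  rewrite -!big_split /=; congr addn.
  apply: eq_bigr => p fp; have [w1 w2] := swP s sP.
  rewrite /inv w1 w2 (fixP p fp); have := ltP s sP.
  by case: (ltgtP p s.1); case: (ltgtP p s.2) => //= p2 p1 s12;
    have := lt_trans s12 (lt_trans p2 p1); rewrite ltxx.
(* For s = t the arc itself is one inversion; R and C are then zero. *)
have key s t : s \in P -> t \in P ->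
    (G s t + (s == t) + 2 * R s t + 2 * R t s + (C s t + C t s) = 2)%N.
  move=> sP tP; have [ws1 ws2] := swP s sP; have [wt1 wt2] := swP t tP.
  have s12 := ltP s sP; have t12 := ltP t tP.
  have [h hlt] := nat_order_embedding.
  have h_inj x y : h x = h y -> x = y.
    by move=> hxy; case: (ltgtP x y) => //; rewrite hlt hxy ltnn.
  rewrite /G /R /C /inv ws1 ws2 wt1 wt2.
  case: (eqVneq s t) => [<-|nst].
    by rewrite !ltxx s12 (lt_gtF s12) /= ?ltxx.
  have apart v u : v \in [:: s.1; s.2] -> u \in [:: t.1; t.2] -> h v <> h u.
    move=> vs ut /h_inj vu; rewrite -vu in ut.
    by rewrite (disP s t v sP tP vs ut) eqxx in nst.
  have := apart s.1 t.1; have := apart s.1 t.2.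
  have := apart s.2 t.1; have := apart s.2 t.2.
  rewrite !inE !eqxx !orbT /= => /(_ isT isT) n22 /(_ isT isT) n21.
  move=> /(_ isT isT) n12 /(_ isT isT) n11.
  rewrite !hlt in s12 t12 *.
  move: (h s.1) (h s.2) (h t.1) (h t.2) s12 t12 n11 n12 n21 n22 => p q x y.
  by case: (ltngtP p x); case: (ltngtP p y); case: (ltngtP q x);
    case: (ltngtP q y) => //=; lia.
have sumP2 (F : V * V -> V * V -> nat) :
  (\sum_(s in P) \sum_(t in P) F t s = \sum_(s in P) \sum_(t in P) F s t)%N.
  by rewrite exchange_big.
(* The factor k is abstract so that the products are not unfolded into sums. *)
have linear k (F1 F2 F3 F4 F5 F6 : V * V -> V * V -> nat) :
    (\sum_(s in P) \sum_(t in P)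
       (F1 s t + F2 s t + k * F3 s t + k * F4 s t + (F5 s t + F6 s t))
     = \sum_(s in P) \sum_(t in P) F1 s t + \sum_(s in P) \sum_(t in P) F2 s t
       + k * \sum_(s in P) \sum_(t in P) F3 s t
       + k * \sum_(s in P) \sum_(t in P) F4 s t
       + (\sum_(s in P) \sum_(t in P) F5 s t
          + \sum_(s in P) \sum_(t in P) F6 s t))%N.
  rewrite !big_distrr -!big_split; apply: eq_bigr => s _ /=.
  by rewrite !big_distrr -!big_split.
have diag : (\sum_(s in P) \sum_(t in P) (s == t))%N = #|P|.
  rewrite -sum1_card; apply: eq_bigr => s sP.
  rewrite (bigD1 s) //= eqxx big1 // => t /andP[_]; rewrite eq_sym.
  by move/negPf->.
have : (\sum_(s in P) \sum_(t in P)
   (G s t + (s == t) + 2 * R s t + 2 * R t s + (C s t + C t s))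
   = \sum_(s in P) \sum_(t in P) 2)%N.
  by apply: eq_bigr => s sP; apply: eq_bigr => t tP; apply: key.
rewrite (linear 2 G (fun s t => s == t : nat) R (fun s t => R t s) C
  (fun s t => C t s)) diag (sumP2 R) (sumP2 C) !sum_nat_const.
rewrite !expnS expn0 muln1; lia.
Qed.
End Inversions.

(** * Reflections in pairwise orthogonal vectors *)

Section Inner.
Context {n : nat}.
Implicit Types (x y z b : vec n) (l : seq (vec n)).

Lemma innerE x y : inner x y = \sum_i x 0 i * y 0 i.
Proof. by rewrite /inner mxE; apply: eq_bigr => i _; rewrite mxE. Qed.

Lemma innerC x y : inner x y = inner y x.
Proof. by rewrite !innerE; apply: eq_bigr => i _; rewrite mulrC. Qed.

Lemma innerBl x y z : inner (x - y) z = inner x z - inner y z.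
Proof. by rewrite /inner mulmxBl !mxE. Qed.

Lemma innerBr x y z : inner z (x - y) = inner z x - inner z y.
Proof. by rewrite !(innerC z) innerBl. Qed.

Lemma innerZl a x y : inner (a *: x) y = a * inner x y.
Proof. by rewrite /inner -scalemxAl mxE. Qed.

Lemma innerZr a x y : inner x (a *: y) = a * inner x y.
Proof. by rewrite !(innerC x) innerZl. Qed.

Lemma mulmx_reflection x b :
  x *m reflection b = x - (2 / inner b b * inner x b) *: b.
Proof.
rewrite /reflection mulmxBr mulmx1 -scalemxAr mulmxA.
by rewrite [x *m _]mx11_scalar mul_scalar_mx scalerA.
Qed.

(** Unit vectors [x] and [y] are exchanged by the reflection in [y - x], and a
    reflection only depends on the line of its root.  The scalar [a] makes this
    apply to the short roots, which are halves of differences of unit vectors. *)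
Lemma reflection_swap x y a : inner x x = 1 -> inner y y = 1 ->
  inner x y != 1 -> a != 0 -> x *m reflection (a *: (y - x)) = y.
Proof.
move=> xx yy xy a0; rewrite mulmx_reflection scalerA.
rewrite !(innerZl, innerZr, innerBl, innerBr) xx yy (innerC y).
have xy0 : inner x y - 1 != 0 by rewrite subr_eq0.
have -> : 2 / (a * (a * (1 - inner x y - (inner x y - 1)))) *
    (a * (inner x y - 1)) * a = -1 :> rat.
  move: (inner x y) xy0 => k xy0.
  have -> : 1 - k - (k - 1) = -2 * (k - 1) :> rat by ring.
  by field; rewrite a0 xy0.
by rewrite scaleN1r opprK addrC subrK.
Qed.

Lemma mulmx_reflections_id l x : (forall b, b \in l -> inner x b = 0) ->
  x *m \big[mulmx/1%:M]_(b <- l) reflection b = x.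
Proof.
elim: l => [|b l IHl] xl; first by rewrite big_nil mulmx1.
rewrite big_cons mulmxA mulmx_reflection xl ?mem_head // mulr0 scale0r subr0.
by apply: IHl => c cl; rewrite xl // inE cl orbT.
Qed.

(** Once the factor [b] has moved [x] to a combination of [x] and [b], the
    remaining factors still fix it; this makes the order of the factors
    irrelevant. *)
Lemma mulmx_reflections_single l x b : uniq l -> b \in l ->
  (forall c, c \in l -> c != b -> inner x c = 0 /\ inner b c = 0) ->
  x *m \big[mulmx/1%:M]_(c <- l) reflection c = x *m reflection b.
Proof.
elim: l => [//|c l IHl] /= /andP[cl ul]; rewrite inE => bl orth.
have orthl e : e \in l -> e != b -> inner x e = 0 /\ inner b e = 0.
  by move=> el; apply: orth; rewrite inE el orbT.
rewrite big_cons mulmxA; case: (eqVneq b c) bl => [ebc|nbc] /= bl.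
  subst c; apply: mulmx_reflections_id => e el.
  have neb : e != b by apply: contraTneq el => ->.
  have [xe be] := orthl e el neb.
  by rewrite mulmx_reflection innerBl innerZl xe be mulr0 subr0.
have [xc _] : inner x c = 0 /\ inner b c = 0.
  by apply: orth; rewrite ?mem_head // eq_sym.
by rewrite [x *m reflection c]mulmx_reflection xc mulr0 scale0r subr0 IHl.
Qed.

End Inner.

(** * The product of reflections as a permutation of vertices *)

Section Realization.
Context {d : Order.disp_t} {V : finOrderType d} {n : nat}.
Variables (f : V -> vec n) (S : {fset vec n}) (P : {set V * V}).
Hypothesis f_unit : forall v, inner (f v) (f v) = 1.
Hypothesis f_inj : forall u v, inner (f u) (f v) = 1 -> u = v.
Hypothesis orthS : forall b c, b \in S -> c \in S -> b != c -> inner b c = 0.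
Hypothesis oneS : forall v b c, b \in S -> c \in S ->
  inner (f v) b != 0 -> inner (f v) c != 0 -> b = c.
Hypothesis arc_lt : forall s, s \in P -> (s.1 < s.2)%O.
Hypothesis arc_root : forall s, s \in P ->
  exists2 b, b \in S & exists2 a, a != 0 & b = a *: (f s.2 - f s.1).
Hypothesis fixed_orth :
  forall v b, fixed_point P v -> b \in S -> inner (f v) b = 0.

Let f_eq u v : f u = f v -> u = v.
Proof. by move=> fuv; apply: f_inj; rewrite fuv f_unit. Qed.

(** The root behind an arc reflects the two end points into each other, and is
    orthogonal to neither of them. *)
Lemma arc_reflection s : s \in P -> exists b, [/\ b \in S,
  f s.1 *m reflection b = f s.2, f s.2 *m reflection b = f s.1,
  inner (f s.1) b != 0 & inner (f s.2) b != 0].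
Proof.
move=> sP; have [b bS [a a0 eb]] := arc_root sP.
have s12 : inner (f s.1) (f s.2) != 1.
  by apply: contraTneq (arc_lt sP) => /f_inj->; rewrite ltxx.
exists b; split=> //.
- by rewrite eb reflection_swap.
- by rewrite eb -opprB scalerN -scaleNr reflection_swap ?oppr_eq0 // innerC.
- by rewrite eb innerZr innerBr f_unit mulf_neq0 // subr_eq0.
- by rewrite eb innerZr innerBr f_unit (innerC (f s.2)) mulf_neq0 // subr_eq0 eq_sym.
Qed.

(** Two arcs with a common end point come from the same root, because only one
    root of [S] is not orthogonal to that end point; the reflection in this root
    then sends the common end point to the other end point of both arcs. *)
Lemma link_pattern_of_roots : link_pattern P.
Proof.
split=> // s t v sP tP; rewrite !inE.
have [b [bS b12 b21 b1 b2]] := arc_reflection sP.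
have [c [cS c12 c21 c1 c2]] := arc_reflection tP.
have slt := arc_lt sP; have tlt := arc_lt tP.
case/orP=> /eqP->{v} /orP[] /eqP e.
- have {}b1 : inner (f t.1) b != 0 by rewrite -e.
  have bc := oneS bS cS b1 c1; rewrite -bc -e b12 in c12.
  by rewrite [s]surjective_pairing [t]surjective_pairing e (f_eq c12).
- have {}b1 : inner (f t.2) b != 0 by rewrite -e.
  have bc := oneS bS cS b1 c2; rewrite -bc -e b12 in c21.
  by rewrite -(f_eq c21) -e (lt_gtF slt) in tlt.
- have {}b2 : inner (f t.1) b != 0 by rewrite -e.
  have bc := oneS bS cS b2 c1; rewrite -bc -e b21 in c12.
  by rewrite -(f_eq c12) -e (lt_gtF slt) in tlt.
- have {}b2 : inner (f t.2) b != 0 by rewrite -e.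
  have bc := oneS bS cS b2 c2; rewrite -bc -e b21 in c21.
  by rewrite [s]surjective_pairing [t]surjective_pairing e (f_eq c21).
Qed.

Lemma mulmx_sigma_reflection v b : b \in S -> inner (f v) b != 0 ->
  f v *m sigma S = f v *m reflection b.
Proof.
move=> bS vb; apply: mulmx_reflections_single => // [|c cS ncb].
  exact: fset_uniq.
split; last by rewrite orthS // eq_sym.
by apply/eqP; apply: contraNT ncb => vc; rewrite (oneS cS bS vc vb).
Qed.

(** A vertex on an arc is moved by the reflection of that arc alone, and a fixed
    point is orthogonal to all the roots. *)
Lemma sigma_swaps : exists w : {perm V},
  swaps P w /\ forall v, f v *m sigma S = f (w v).
Proof.
have [ltP disP] := link_pattern_of_roots.
have partner v : exists u, (fixed_point P v /\ u = v) \/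
    exists2 s, s \in P & s = (v, u) \/ s = (u, v).
  case: (boolP (fixed_point P v)) => [fv|]; first by exists v; left.
  rewrite negb_forall => /existsP[s]; rewrite negb_imply => /andP[sP].
  rewrite negb_and !negbK => /orP[] /eqP->.
  - by exists s.2; right; exists s => //; left; case: (s).
  - by exists s.1; right; exists s => //; right; case: (s).
have [w wP] := fin_all_exists partner.
have sw : swaps P w.
  split=> [s sP|v fv].
    have nfix v : v \in [:: s.1; s.2] -> ~ fixed_point P v.
      move=> vs /forallP/(_ s); rewrite sP /=; move: vs; rewrite !inE.
      by case/orP=> ->; rewrite ?andbF.
    split.
    + case: (wP s.1) => [[/nfix]|[t tP st]]; first by rewrite inE eqxx => /(_ isT).
      have et : t = s.
        by apply: (disP t s s.1) => //; first case: st => ->;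
          rewrite !inE eqxx ?orbT.
      case: st => e; first by rewrite -et e.
      by have := ltP s sP; rewrite -{2}et e ltxx.
    + case: (wP s.2) => [[/nfix]|[t tP st]].
        by rewrite !inE eqxx orbT => /(_ isT).
      have et : t = s.
        by apply: (disP t s s.2) => //; first case: st => ->;
          rewrite !inE eqxx ?orbT.
      case: st => e; last by rewrite -et e.
      by have := ltP s sP; rewrite -{1}et e ltxx.
  case: (wP v) => [[]//|[s sP sv]].
  move/forallP/(_ s): fv; rewrite sP /=.
  by case: sv => ->; rewrite /= eqxx ?andbF.
have fw v : f v *m sigma S = f (w v).
  have [sw1 sw2] := sw.
  case: (wP v) => [[fv ->]|[s sP sv]].
    by apply: mulmx_reflections_id => b bS; apply: fixed_orth.
  have [b [bS b12 b21 b1 b2]] := arc_reflection sP.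
  have [w1 w2] := sw1 s sP.
  case: sv => es; rewrite es /= in b12 b21 b1 b2 w1 w2 *.
  - by rewrite (mulmx_sigma_reflection bS b1).
  - by rewrite (mulmx_sigma_reflection bS b2).
have wK : involutive w.
  move=> v; have [sw1 sw2] := sw.
  case: (wP v) => [[fv ->]|[s sP sv]]; first exact: sw2.
  have [w1 w2] := sw1 s sP.
  by case: sv => es; rewrite es /= in w1 w2.
exists (perm (inv_inj wK)); split=> [|v]; last by rewrite permE.
by case: sw => sw1 sw2; split=> [s sP|v fv]; rewrite !permE; auto.
Qed.
End Realization.

(** * Roots as pairs of signed vertices *)

Section Signed.
Context {n : nat}.
Implicit Types (u v : svertex n) (s t x y : svertex n * svertex n) (b : vec n).

Definition svec v : vec n := (-1) ^+ v.1 *: evec v.2.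

(** Each root of type C is a difference of two of the vectors +e_i, -e_i, so a
    pair of signed vertices represents it; the positive roots are represented by
    the increasing pairs, exactly as in type A. *)
Definition pair_root x : vec n := svec x.2 - svec x.1.

(** The only identification that [pair_root] makes among the increasing pairs. *)
Definition flip x : svertex n * svertex n := (svopp x.2, svopp x.1).

Lemma svoppK : involutive (@svopp n).
Proof. by case=> e i; rewrite /svopp /= negbK. Qed.

Lemma flipK : involutive flip.
Proof. by case=> u v; rewrite /flip /= !svoppK. Qed.

Lemma svval_opp v : svval (svopp v) = - svval v.
Proof. by case: v => [[] i]; rewrite /svval /= ?expr1 ?expr0 !mulN1r ?mul1r ?opprK. Qed.

Lemma lt_svopp u v : (svopp u < svopp v)%O = (v < u)%O.
Proof. by rewrite !lt_svertexE !svval_opp ltrN2. Qed.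

Lemma lt_flip x : ((flip x).1 < (flip x).2)%O = (x.1 < x.2)%O.
Proof. exact: lt_svopp. Qed.

Lemma lt_sv (e e' : bool) (i j : 'I_n) : (((e, i) : svertex n) < (e', j))%O =
  if e then ~~ e' || (j < i)%N else ~~ e' && (i < j)%N.
Proof.
rewrite lt_svertexE /svval /=; case: e; case: e' => /=;
  rewrite ?expr1 ?expr0 ?mulN1r ?mul1r; lia.
Qed.

Lemma svecE v i : svec v 0 i = (-1) ^+ v.1 * (v.2 == i)%:R.
Proof. by rewrite !mxE eqxx /= eq_sym. Qed.

Lemma svec_opp v : svec (svopp v) = - svec v.
Proof.
by case: v => [[] i]; rewrite /svec /= ?expr1 ?expr0 ?scaleN1r ?scale1r ?opprK.
Qed.

Lemma inner_svec v b : inner (svec v) b = (-1) ^+ v.1 * b 0 v.2.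
Proof.
rewrite innerE (bigD1 v.2) //= svecE eqxx mulr1 big1 ?addr0 // => i ni.
by rewrite svecE eq_sym (negPf ni) mulr0 mul0r.
Qed.

Lemma inner_svec_neq0 v b : (inner (svec v) b != 0) = (v.2 \in indices b).
Proof. by rewrite inner_svec mulf_eq0 signr_eq0 /= inE. Qed.

Lemma inner_svec_unit v : inner (svec v) (svec v) = 1.
Proof. by rewrite inner_svec svecE eqxx mulr1 -signr_addb addbb. Qed.

Lemma inner_svec_inj u v : inner (svec u) (svec v) = 1 -> u = v.
Proof.
rewrite inner_svec svecE mulrA -signr_addb.
case: u v => [e i] [e' j] /=; case: eqVneq => [->|_]; rewrite ?mulr0 //.
by rewrite mulr1; case: e; case: e'.
Qed.

Lemma svec_inj : injective svec.
Proof. by move=> u v uv; apply: inner_svec_inj; rewrite uv inner_svec_unit. Qed.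

Lemma pair_root_flip x : pair_root (flip x) = pair_root x.
Proof. by rewrite /pair_root /= !svec_opp opprK addrC. Qed.

Lemma indices_pair_root x i : i \in indices (pair_root x) -> i = x.1.2 \/ i = x.2.2.
Proof.
rewrite inE !mxE !eqxx /=; case: (eqVneq i x.1.2) => [->|_]; first by left.
by case: (eqVneq i x.2.2) => [->|_]; [right | rewrite !mulr0 subr0 eqxx].
Qed.

(** A linear functional that takes the value [svval v] on [svec v], hence
    is positive on exactly those pair roots whose pair is increasing. *)
Definition height b : rat := \sum_i b 0 i * (i.+1)%:R.

Lemma heightB b c : height (b - c) = height b - height c.
Proof.
by rewrite /height -sumrB; apply: eq_bigr => i _; rewrite !mxE mulrBl.
Qed.

Lemma height_svec v : height (svec v) = (svval v)%:~R.
Proof.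
rewrite /height (bigD1 v.2) //= svecE eqxx mulr1 big1 ?addr0 => [|i ni].
  by rewrite /svval intrM rmorph_sign.
by rewrite svecE eq_sym (negPf ni) mulr0 mul0r.
Qed.

Lemma height_pair_root x : (0 < height (pair_root x)) = (x.1 < x.2)%O.
Proof. by rewrite heightB !height_svec subr_gt0 ltr_int lt_svertexE. Qed.

(** Selects one pair from each [flip] orbit: -x.2 <= x.1, with equality for the
    pairs fixed by [flip], which represent the long roots. *)
Definition upper x : bool := (svopp x.2 <= x.1)%O.

Lemma upper_flip x : x.1 != svopp x.2 -> upper (flip x) = ~~ upper x.
Proof.
by move=> nx; rewrite /upper /= svoppK -ltNge lt_neqAle nx.
Qed.

(** An increasing upper pair is the usual writing of a positive root,
    e_j - e_i or e_j + e_i with i < j, or 2 e_j. *)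
Lemma upper_root_shape x : upper x -> (x.1 < x.2)%O ->
  [/\ ~~ x.2.1, (x.1.2 <= x.2.2)%N & ~~ x.1.1 -> (x.1.2 < x.2.2)%N].
Proof.
case: x => [[e i] [e' j]]; rewrite /upper /= leNgt /svopp /= !lt_sv /=.
by case: e; case: e' => //=; rewrite -?leqNgt => ij ji; split=> //; lia.
Qed.

(** The larger index of an increasing upper pair is the last nonzero coordinate of
    its root; cancelling its unit vector leaves the other vertex. *)
Lemma pair_root_inj x y : upper x -> (x.1 < x.2)%O -> upper y -> (y.1 < y.2)%O ->
  pair_root x = pair_root y -> x = y.
Proof.
(* Nonzero: the coordinate is 1, or 2 for a long root. *)
have top z : upper z -> (z.1 < z.2)%O -> pair_root z 0 z.2.2 != 0.
  move=> uz ltz; have [/negPf p2 le12 lt12] := upper_root_shape uz ltz.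
  rewrite !mxE p2 !eqxx expr0 mul1r /=.
  case: (eqVneq z.2.2 z.1.2) => [e|_]; last by rewrite mulr0 subr0.
  case: z.1.1 lt12 => [_|/(_ isT)]; last by rewrite e ltnn.
  by rewrite expr1 mulN1r opprK.
have above z (k : 'I_n) : upper z -> (z.1 < z.2)%O -> (z.2.2 < k)%N ->
    pair_root z 0 k = 0.
  move=> uz ltz; have [_ le12 _] := upper_root_shape uz ltz => zk.
  rewrite !mxE eqxx /= -!val_eqE /= !gtn_eqF ?mulr0 ?subr0 //.
  exact: leq_ltn_trans zk.
move=> ux ltx uy lty e.
have [/negPf px _ _] := upper_root_shape ux ltx.
have [/negPf py _ _] := upper_root_shape uy lty.
have e2 : x.2 = y.2.
  rewrite [x.2]surjective_pairing [y.2]surjective_pairing px py; congr pair.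
  apply: val_inj => /=; case: (ltngtP x.2.2 y.2.2) => // h.
  - by have := top y uy lty; rewrite -e above ?eqxx.
  - by have := top x ux ltx; rewrite e above ?eqxx.
move: e; rewrite /pair_root e2 => /addrI/oppr_inj/svec_inj e1.
by rewrite [x]surjective_pairing [y]surjective_pairing e1 e2.
Qed.

Lemma pair_root_difference (i j : 'I_n) :
  pair_root ((false, i), (false, j)) = evec j - evec i.
Proof. by rewrite /pair_root /svec /= !scale1r. Qed.

Lemma pair_root_sum (i j : 'I_n) : pair_root ((true, i), (false, j)) = evec j + evec i.
Proof. by rewrite /pair_root /svec /= expr1 scale1r scaleN1r opprK. Qed.

Lemma pair_root_long (i : 'I_n) : pair_root ((true, i), (false, i)) = 2 *: evec i.
Proof. by rewrite pair_root_sum scaler_nat mulr2n. Qed.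

Lemma posD_upper b : reflect
  (exists x, [/\ upper x, (x.1 < x.2)%O, x.1 != svopp x.2 & b = pair_root x])
  (b \in posD n).
Proof.
apply: (iffP idP) => [|[[[e i] [e' j]] [ux ltx nx ->]]].
  rewrite inE => /orP[] /imfsetP[[i j] /= ij ->]; rewrite inE /= in ij.
  - exists ((false, i), (false, j)); split; rewrite ?pair_root_difference //.
    by rewrite /= lt_sv.
  - exists ((true, i), (false, j)); split; rewrite ?pair_root_sum //.
    + by rewrite /upper leNgt /svopp /= lt_sv /= -leqNgt ltnW.
    + by apply: contraTneq ij => -[->]; rewrite ltnn.
have [/= /negPf e'0 le12 lt12] := upper_root_shape ux ltx; subst e'.
case: e {ux ltx} nx lt12 => /= nx lt12; rewrite ?pair_root_difference ?pair_root_sum inE.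
- apply/orP; right; apply/imfsetP; exists (i, j) => //=; rewrite inE /=.
  rewrite ltn_neqAle le12 andbT; apply: contraNneq nx => /val_inj->.
  by rewrite /svopp.
- by apply/orP; left; apply/imfsetP; exists (i, j) => //=; rewrite inE /= lt12.
Qed.

Lemma posC_upper b : reflect
  (exists x, [/\ upper x, (x.1 < x.2)%O & b = pair_root x]) (b \in posC n).
Proof.
apply: (iffP idP) => [|[x [ux ltx ->]]]; rewrite inE.
  case/orP=> [/posD_upper[x [ux ltx _ ->]]|]; first by exists x.
  case/imfsetP => i _ ->; exists ((true, i), (false, i)).
  by rewrite pair_root_long /upper /= lt_sv lexx.
case: (eqVneq x.1 (svopp x.2)) => [e|nx]; apply/orP; [right|left].
  apply/imfsetP; exists x.2.2 => //.
  have [/negPf px _ _] := upper_root_shape ux ltx.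
  rewrite -pair_root_long [x]surjective_pairing e; case: x.2 px => [? ?] /= ->.
  by [].
by apply/posD_upper; exists x.
Qed.

Lemma upper_or_flip x :
  upper x \/ [/\ upper (flip x) & x.1 != svopp x.2].
Proof.
case: (boolP (upper x)) => [|nu]; [by left | right].
have nx : x.1 != svopp x.2 by apply: contraNneq nu; rewrite /upper => ->.
by rewrite upper_flip.
Qed.

Lemma mem_posC x : (pair_root x \in posC n) = (x.1 < x.2)%O.
Proof.
apply/posC_upper/idP => [[y [_ lty e]]|ltx].
  by rewrite -height_pair_root e height_pair_root.
case: (upper_or_flip x) => [ux|[ux _]]; first by exists x.
by exists (flip x); rewrite pair_root_flip lt_flip.
Qed.

Lemma mem_posD x : (pair_root x \in posD n) = (x.1 < x.2)%O && (x.1 != svopp x.2).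
Proof.
apply/posD_upper/andP => [[y [uy lty ny e]]|[ltx nx]].
  have ltx : (x.1 < x.2)%O by rewrite -height_pair_root e height_pair_root.
  split=> //; apply: contraNneq ny => ex; have ux : upper x by rewrite /upper ex.
  by rewrite -(pair_root_inj ux ltx uy lty e) ex.
case: (upper_or_flip x) => [ux|[ux _]]; first by exists x.
exists (flip x); rewrite pair_root_flip lt_flip; split=> //=.
by rewrite svoppK eq_sym.
Qed.

End Signed.

(** * Lengths as numbers of inversions *)

Lemma card_fset_image (T : finType) (K : choiceType) (A : {set T}) (f : T -> K) :
  {in A &, injective f} -> #|` [fset f x | x in A]| = #|A|.
Proof. by move=> injf; rewrite card_in_imfset //= -cardE. Qed.

(** If [w] describes the action of [M] on the vectors [f v], and the pairs
    satisfying [K] represent each positive root exactly once, then the positive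
    roots made negative by [M] are the inversions of [w] that satisfy [K]. *)
Lemma weyl_length_inversions (d : Order.disp_t) (V : finOrderType d) n
    (f : V -> vec n) (pos : {fset vec n}) (K : pred (V * V)) (w : V -> V) M :
  (forall b, reflect
     (exists x, [/\ K x, (x.1 < x.2)%O & b = f x.2 - f x.1]) (b \in pos)) ->
  (forall x y, K x -> (x.1 < x.2)%O -> K y -> (y.1 < y.2)%O ->
     f x.2 - f x.1 = f y.2 - f y.1 -> x = y) ->
  (forall x, K x -> (x.1 < x.2)%O ->
     (f (w x.1) - f (w x.2) \in pos) = (w x.2 < w x.1)%O) ->
  (forall v, f v *m M = f (w v)) ->
  weyl_length pos M = #|[set x in inversions w | K x]|.
Proof.
move=> posP injf posw fM.
rewrite -(@card_fset_image _ _ _ (fun x => f x.2 - f x.1)) => [|x y]; last first.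
  rewrite !inE => /andP[/andP[ltx _] Kx] /andP[/andP[lty _] Ky]; exact: injf.
congr #|` _|; apply/fsetP => b; apply/idP/imfsetP => /=.
  rewrite !inE => /andP[/posP[x [Kx ltx ->]]].
  rewrite mulmxBl !fM opprB posw // => ltw.
  by exists x => //; rewrite !inE Kx ltx ltw.
case=> x; rewrite !inE => /andP[/andP[ltx ltw] Kx] ->.
rewrite mulmxBl !fM opprB posw // ltw andbT.
by apply/posP; exists x.
Qed.

Section SignedCounting.
Context {n : nat}.
Implicit Types (u v : svertex n) (s t x y : svertex n * svertex n) (b : vec n).

Lemma lt_svopp_self v : (v < svopp v)%O = v.1.
Proof. by case: v => [[] i]; rewrite /svopp /= lt_sv. Qed.

(** [flip] exchanges the upper and the non-upper elements of [A] among the pairs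
    that it moves, and the pairs that it fixes are the (-v, v). *)
Lemma card_flip (A : {set svertex n * svertex n}) :
  (forall x, x \in A -> flip x \in A) ->
  #|A| = (2 * #|[set x in A | upper x && (x.1 != svopp x.2)]|
          + #|[set x in A | x.1 == svopp x.2]|)%N.
Proof.
move=> flipA; set U := [set x in A | _ && _]; set D := [set x in A | _ == _].
have cardL : #|[set x in A | ~~ upper x]| = #|U|.
  rewrite -(card_imset _ (inv_inj flipK)); apply: eq_card => x.
  have diag y : ~~ upper y -> y.1 != svopp y.2.
    by apply: contraNneq; rewrite /upper => ->.
  apply/imsetP/idP => [[y]|].
    rewrite !inE => /andP[yA nu] ->; have dy := diag y nu.
    by rewrite flipA // upper_flip // nu /= svoppK eq_sym.
  rewrite !inE => /and3P[xA ux dx]; exists (flip x); rewrite ?flipK //.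
  by rewrite !inE flipA // upper_flip // negbK.
have splitA : #|A| = (#|[set x in A | upper x]| + #|[set x in A | ~~ upper x]|)%N.
  rewrite -(cardsID [set x | upper x] A).
  by congr addn; apply: eq_card => x; rewrite !inE // andbC.
have splitU : #|[set x in A | upper x]| = (#|U| + #|D|)%N.
  rewrite -(cardsID D) addnC; congr addn; apply: eq_card => x; rewrite !inE.
    by case: (x \in A) => //=; rewrite andbC.
  case: (x \in A); rewrite ?andbF //=; case: eqP => [e|]; rewrite ?andbF ?andbT //.
  by rewrite /upper e lexx.
by rewrite splitA splitU cardL; lia.
Qed.

Definition negated (w : svertex n -> svertex n) : {set 'I_n} :=
  [set i | (w (svpos i)).1].

Section Perm.
Variable w : {perm svertex n}.
Hypothesis signed_w : signed_perm w.

Lemma flip_inversions x : x \in inversions w -> flip x \in inversions w.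
Proof. by rewrite !inE /= !signed_w !lt_svopp. Qed.

(** The pair (-i, i) is inverted exactly when w(i) < w(-i) = -w(i). *)
Lemma diagonal_inversions :
  #|[set x in inversions w | x.1 == svopp x.2]| = #|negated w|.
Proof.
pose g i := (svopp (svpos i), svpos i) : svertex n * svertex n.
have g_inj : injective g by move=> i j [].
rewrite -(card_imset _ g_inj); apply: eq_card => x; apply/idP/imsetP.
  rewrite !inE => /andP[/andP[lt1 lt2] /eqP e].
  rewrite e signed_w lt_svopp_self in lt2.
  rewrite e -{2}(svoppK x.2) lt_svopp_self /= in lt1.
  have ex : x.2 = svpos x.2.2 by rewrite [LHS]surjective_pairing (negPf lt1).
  exists x.2.2; first by rewrite !inE -ex.
  by rewrite /g -ex -e -surjective_pairing.
case=> i; rewrite !inE => wi ->; rewrite /= signed_w lt_svopp_self wi eqxx.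
by [].
Qed.

(** Inversions of [w] on the signed vertices come in [flip] orbits, one for each
    positive root made negative.  An orbit has two elements, except that of a
    long root, which has one; the latter are counted by [negated w]. *)
Lemma weyl_length_C M : (forall v, svec v *m M = svec (w v)) ->
  (2 * weyl_length (posC n) M = #|inversions w| + #|negated w|)%N.
Proof.
move=> sM; rewrite (weyl_length_inversions (K := upper) (w := w) _ _ _ sM).
- rewrite (card_flip flip_inversions) -diagonal_inversions.
  rewrite -(cardsID [set x | x.1 == svopp x.2] [set x in _ | upper x]).
  set D := #|[set x in _ | _ == _]|; set U := #|[set x in _ | _ && _]|.
  have -> : #|[set x in inversions w | upper x] :&: [set x | x.1 == svopp x.2]| = D.
    apply: eq_card => x; rewrite !inE; case: eqP => [e|]; rewrite ?andbF ?andbT //.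
    by rewrite /upper e lexx andbT.
  have -> : #|[set x in inversions w | upper x] :\: [set x | x.1 == svopp x.2]| = U.
    by apply: eq_card => x; rewrite !inE; case: eqP; rewrite ?andbF ?andbT.
  lia.
- exact: posC_upper.
- exact: pair_root_inj.
- move=> x _ _; exact: (mem_posC (w x.2, w x.1)).
Qed.

(** As in type C, but the orbits of size one belong to the long roots, which are
    not roots of type D. *)
Lemma weyl_length_D M : (forall v, svec v *m M = svec (w v)) ->
  (2 * weyl_length (posD n) M + #|negated w| = #|inversions w|)%N.
Proof.
move=> sM; rewrite (weyl_length_inversions
  (K := fun x => upper x && (x.1 != svopp x.2)) (w := w) _ _ _ sM).
- by rewrite (card_flip flip_inversions) -diagonal_inversions.
- move=> b; apply: (iffP (posD_upper b)) => -[x].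
    by case=> ux ltx nx e; exists x; rewrite ux nx.
  by case=> /andP[ux nx] ltx e; exists x.
- by move=> x y /andP[ux _] ltx /andP[uy _] lty; exact: pair_root_inj.
- move=> x /andP[_ nx] _; have := mem_posD (w x.2, w x.1); rewrite /pair_root /= => ->.
  rewrite -signed_w (inj_eq perm_inj) andbC.
  by rewrite -(inj_eq (inv_inj (@svoppK n))) svoppK eq_sym nx.
Qed.
End Perm.
End SignedCounting.

(** * The signed link pattern of a set of roots *)

Section LinkSigned.
Context {n : nat}.
Implicit Types (u v : svertex n) (s t x y : svertex n * svertex n) (b : vec n).
Variable S : {fset vec n}.

(** The three families of arcs become one: an increasing pair is an arc when its
    pair root lies in [S].  A short root e_k contributes the same arc as 2 e_k. *)
Lemma mem_link_signed s : (s \in link_signed S) =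
  (s.1 < s.2)%O && ((pair_root s \in S) || (s.1 == svopp s.2) && (evec s.2.2 \in S)).
Proof.
apply/idP/idP.
  rewrite !in_setU => /orP[/orP[]|].
  - case/imsetP => k; rewrite !inE orbC => kS ->.
    rewrite /svopp /= ?lt_sv /= eqxx /=.
    by rewrite [pair_root _]pair_root_long.
  - case/bigcupP=> -[i j] /= /andP[ij ijS]; rewrite !inE => /orP[] /eqP->.
      by rewrite /svpos /= ?lt_sv ij pair_root_difference ijS.
    rewrite -[(svopp _, _)]/(flip (svpos i, svpos j)) lt_flip pair_root_flip /=.
    by rewrite ?lt_sv pair_root_difference ij ijS.
  - case/bigcupP=> -[i j] /= /andP[ij ijS]; rewrite !inE => /orP[] /eqP->.
      by rewrite /svopp /= ?lt_sv pair_root_sum ijS.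
    by rewrite /svopp /= ?lt_sv pair_root_sum addrC ijS.
case: s => [[e i] [e' j]] /=; rewrite ?lt_sv => /andP[].
have diff (k l : 'I_n) : (k < l)%N -> pair_root ((false, k), (false, l)) \in S ->
    ((svpos k, svpos l) \in link_signed S) &&
    ((svopp (svpos l), svopp (svpos k)) \in link_signed S).
  move=> kl klS; rewrite !in_setU; apply/andP; split;
    apply/orP; left; apply/orP; right; apply/bigcupP; exists (k, l);
    by rewrite ?inE ?eqxx ?orbT //= kl -pair_root_difference.
case: e; case: e' => //=.
- rewrite orbF -pair_root_flip => ji jiS.
  by have /andP[] := diff j i ji jiS.
- move=> _; rewrite pair_root_sum => ijS.
  case: (ltngtP i j) => [ij|ji|/val_inj eij].
  + rewrite !in_setU; apply/orP; right; apply/bigcupP; exists (i, j) => /=.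
      by move: ijS; rewrite ij /= => /orP[//|/andP[/eqP[eij]]]; rewrite eij ltnn in ij.
    by rewrite !inE eqxx.
  + rewrite !in_setU; apply/orP; right; apply/bigcupP; exists (j, i) => /=.
      move: ijS; rewrite ji /= addrC => /orP[//|/andP[/eqP[eij]]].
      by rewrite eij ltnn in ji.
    by rewrite !inE eqxx orbT.
  + rewrite !in_setU; apply/orP; left; apply/orP; left; apply/imsetP.
    subst j; exists i => //; rewrite inE orbC.
    by move: ijS; rewrite -pair_root_sum pair_root_long eqxx.
- by rewrite orbF => ij ijS; have /andP[] := diff i j ij ijS.
Qed.

Hypothesis SBC : forall b, b \in S -> b \in posC n `|` posB n.
Hypothesis disjS : pairwise_disjoint S.

Lemma flip_link s : s \in link_signed S -> flip s \in link_signed S.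
Proof.
rewrite !mem_link_signed lt_flip pair_root_flip /= svoppK => /andP[-> /= /orP[->//|]].
by case/andP=> /eqP-> /= ->; rewrite eqxx orbT.
Qed.

Lemma disjoint_orth b c : b \in S -> c \in S -> b != c -> inner b c = 0.
Proof.
move=> bS cS bc; rewrite innerE big1 // => i _.
apply/eqP; rewrite mulf_eq0; apply: contraT; rewrite negb_or => ni.
by have /setP/(_ i) := disjS bS cS bc; rewrite !inE ni.
Qed.

Lemma disjoint_single v b c : b \in S -> c \in S ->
  inner (svec v) b != 0 -> inner (svec v) c != 0 -> b = c.
Proof.
move=> bS cS; rewrite !inner_svec_neq0 => vb vc.
apply/eqP; apply: contraT => bc.
by have /setP/(_ v.2) := disjS bS cS bc; rewrite in_setI vb vc inE.
Qed.

(** The scalar is 1 except for the arc of a short root e_k, whose pair root is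
    2 e_k; there it is 1/2, the sign in the witness being that of the right end
    point of (-k, k), which is positive. *)
Lemma arc_to_root s : s \in link_signed S ->
  exists2 b, b \in S & exists2 a, a != 0 & b = a *: (svec s.2 - svec s.1).
Proof.
rewrite mem_link_signed => /andP[lts /orP[sS|/andP[/eqP e sS]]].
  by exists (pair_root s) => //; exists 1; rewrite ?oner_eq0 ?scale1r.
exists (evec s.2.2) => //; exists ((-1) ^+ s.2.1 / 2).
  by case: s.2.1.
rewrite e svec_opp opprK -mulr2n -scaler_nat scalerA mulfVK // /svec.
by rewrite scalerA -signr_addb addbb scale1r.
Qed.

Lemma root_to_arc b : b \in S -> exists2 s, s \in link_signed S &
  exists a, b = a *: (svec s.2 - svec s.1).
Proof.
move=> bS; have {}bpos : b \in posC n \/ b \in short_roots n.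
  have := SBC bS; rewrite inE => /orP[bC|]; first by left.
  rewrite inE => /orP[bD|]; [left | by right].
  by rewrite inE bD.
case: bpos => [/posC_upper[x [_ ltx e]]|/imfsetP[i _ e]].
  exists x; first by rewrite mem_link_signed ltx -e bS.
  by exists 1; rewrite scale1r.
exists (svopp (svpos i), svpos i).
  by rewrite mem_link_signed /= eqxx -e bS orbT.
exists (2^-1); rewrite e -[_ - _]/(pair_root ((true, i), (false, i))) pair_root_long.
by rewrite scalerA mulVf // scale1r.
Qed.

Lemma inner_svec0 u v : v != u -> v != svopp u -> inner (svec v) (svec u) = 0.
Proof.
case: u v => [e i] [e' j]; rewrite /svopp /= !xpair_eqE inner_svec svecE /=.
case: (eqVneq j i) => [_|_ _ _]; last by rewrite !mulr0.
by rewrite !andbT; case: e; case: e'.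
Qed.

(** The link pattern is stable under [flip], so the opposite of a fixed point is
    not an end point of an arc either. *)
Lemma fixed_link_orth v b :
  fixed_point (link_signed S) v -> b \in S -> inner (svec v) b = 0.
Proof.
move=> /forallP fv bS; have [s sP [a ->]] := root_to_arc bS.
have /implyP/(_ sP)/andP[n1 n2] := fv s.
have /implyP/(_ (flip_link sP))/andP[n3 n4] := fv (flip s).
by rewrite innerZr innerBr !inner_svec0 ?subrr ?mulr0.
Qed.

(** The permutation given by [sigma_swaps] is signed because the matrix sends
    opposite vectors to opposite vectors. *)
Lemma signed_realization : exists w : {perm svertex n},
  [/\ signed_perm w, link_pattern (link_signed S), swaps (link_signed S) w
    & forall v, svec v *m sigma S = svec (w v)].
Proof.
have arc_lt s : s \in link_signed S -> (s.1 < s.2)%O.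
  by rewrite mem_link_signed => /andP[].
have [w [sw wE]] := sigma_swaps inner_svec_unit inner_svec_inj disjoint_orth
  disjoint_single arc_lt arc_to_root fixed_link_orth.
exists w; split=> //; last first.
  exact: (link_pattern_of_roots inner_svec_unit inner_svec_inj disjoint_single
    arc_lt arc_to_root).
by move=> v; apply: svec_inj; rewrite -wE !svec_opp mulNmx wE.
Qed.

End LinkSigned.

(** * Counting the arcs that cross zero *)

Section LinkCounting.
Context {n : nat}.
Implicit Types (s : svertex n * svertex n) (S : {fset vec n}).

Definition crossing_zero s : bool := s.1.1 && ~~ s.2.1.

(** The vertex i is sent to a negative vertex exactly when the arc ending at i
    starts on the negative side. *)
Lemma card_negated (P : {set svertex n * svertex n}) (w : {perm svertex n}) :
  link_pattern P -> swaps P w ->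
  #|negated w| = #|[set s in P | crossing_zero s]|.
Proof.
move=> [ltP _] [sw1 sw2].
pose g i := (w (svpos i), svpos i) : svertex n * svertex n.
have g_inj : injective g by move=> i j [].
rewrite -(card_imset _ g_inj); apply: eq_card => s; apply/imsetP/idP.
  case=> i wi {s}->; have {}wi : (w (svpos i)).1 by move: wi; rewrite !inE.
  case: (boolP (fixed_point P (svpos i))) => [/sw2 fi|].
    by rewrite fi in wi.
  rewrite negb_forall => /existsP[t]; rewrite negb_imply => /andP[tP].
  have [w1 w2] := sw1 t tP; have := ltP t tP.
  rewrite negb_and !negbK => ltt /orP[] /eqP e.
    rewrite e w1 in wi; rewrite -e in ltt.
    by rewrite [t.2]surjective_pairing wi lt_sv in ltt.
  have -> : g i = t by rewrite /g e w2 -surjective_pairing.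
  by rewrite inE tP /crossing_zero -w2 -e wi.
rewrite !inE => /andP[sP /andP[s1 s2]]; have [w1 w2] := sw1 s sP.
have es : s.2 = svpos s.2.2 by rewrite [LHS]surjective_pairing (negPf s2).
exists s.2.2; first by rewrite !inE -es w2.
by rewrite /g -es w2 -surjective_pairing.
Qed.

Lemma difference_inj : {in [pred p : 'I_n * 'I_n | (p.1 < p.2)%N] &,
  injective (fun p : 'I_n * 'I_n => evec p.2 - evec p.1 : vec n)}.
Proof.
move=> [i j] [k l]; rewrite !inE /= => ij kl.
rewrite -!pair_root_difference => /pair_root_inj.
by rewrite !lt_sv => /(_ isT ij isT kl)[-> ->].
Qed.

Lemma card_linkA S : #|linkA S| = #|` S `&` difference_roots n|.
Proof.
rewrite -(card_fset_image (f := fun p => evec p.2 - evec p.1)) => [|p q]; last first.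
  by rewrite !inE => /andP[ltp _] /andP[ltq _]; apply: difference_inj.
congr #|` _|; apply/fsetP => b; rewrite inE; apply/imfsetP/andP => /=.
  case=> p; rewrite !inE => /andP[ltp pS] ->; split=> //.
  by apply/imfsetP; exists p.
case=> bS /imfsetP[p ltp e]; exists p => //.
by rewrite !inE -e bS andbT; move: ltp; rewrite inE.
Qed.

(** Among the arcs, those on one side of zero come in [flip] pairs; the one on the
    positive side is the arc of a root e_j - e_i of [S]. *)
Lemma card_noncrossing S :
  #|[set s in link_signed S | ~~ crossing_zero s]|
  = (2 * #|` S `&` difference_roots n|)%N.
Proof.
rewrite -card_linkA card_flip => [|s]; last first.
  rewrite inE => /andP[sP nc]; rewrite inE flip_link //.
  by move: nc; rewrite /crossing_zero /= andbC negbK.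
have -> : [set s in [set s in link_signed S | ~~ crossing_zero s]
    | s.1 == svopp s.2] = finset.set0.
  apply/setP => s; rewrite in_set0; apply/negP.
  rewrite inE => /andP[/[1!inE] /andP[sP nc] /eqP e].
  move: sP nc; rewrite mem_link_signed => /andP[lts _].
  rewrite e -{2}(svoppK s.2) lt_svopp_self in lts.
  by rewrite /= in lts; rewrite /crossing_zero e /= lts.
(* An upper arc that does not cross zero lies on the positive side. *)
rewrite cards0 addn0; congr (_ * _)%N.
pose g (p : 'I_n * 'I_n) := (svpos p.1, svpos p.2) : svertex n * svertex n.
have g_inj : injective g by case=> i j [k l] [-> ->].
rewrite -[RHS](card_imset _ g_inj); apply: eq_card => s; apply/idP/imsetP.
  rewrite inE => /andP[/[1!inE]/andP[]].
  rewrite mem_link_signed => /andP[lts sS] nc /andP[us ds].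
  have [p2 _ _] := upper_root_shape us lts.
  rewrite (negPf ds) orbF in sS; rewrite /crossing_zero p2 andbT in nc.
  case: s p2 nc lts sS {us ds} => [[e i] [e' j]] /= /negPf-> /negPf->.
  rewrite lt_sv pair_root_difference /= => ij ijS.
  by exists (i, j); rewrite // inE ij.
case=> -[i j] ijP ->; rewrite inE inE.
have /andP[/= ij ijS] : (i < j)%N && (evec j - evec i \in S).
  by move: ijP; rewrite !inE.
rewrite mem_link_signed /g /= lt_sv pair_root_difference ijS /= andbT.
by rewrite ij /upper.
Qed.

Lemma card_link_signed S : #|link_signed S| =
  (#|[set s in link_signed S | crossing_zero s]|
   + 2 * #|` S `&` difference_roots n|)%N.
Proof.
rewrite -card_noncrossing -(cardsID [set s | crossing_zero s] (link_signed S)).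
by congr addn; apply: eq_card => s; rewrite !inE // andbC.
Qed.

(** The roots e_j + e_i contribute two crossing arcs each, and the short roots one
    each. *)
Lemma odd_crossing_zero S : S `<=` posB n ->
  odd #|[set s in link_signed S | crossing_zero s]|
  = odd #|` S `&` short_roots n|.
Proof.
move=> SB; rewrite card_flip => [|s]; last first.
  rewrite inE => /andP[sP nc]; rewrite inE flip_link //.
  by move: nc; rewrite /crossing_zero /= andbC negbK.
rewrite oddD oddM /=; congr odd.
pose T := [set i : 'I_n | evec i \in S].
have -> : #|` S `&` short_roots n| = #|T|.
  have evec_inj : injective (@evec n).
    move=> i j; rewrite -[evec i]scale1r -[evec j]scale1r.
    by move/(@svec_inj n (svpos i) (svpos j)) => [].
  rewrite -(card_fset_image (f := @evec n)) => [|i j _ _]; last exact: evec_inj.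
  congr #|` _|; apply/fsetP => b; rewrite inE; apply/andP/imfsetP => /=.
    by case=> bS /imfsetP[i _ e]; exists i; rewrite // inE -e.
  by case=> i; rewrite inE => iS ->; split=> //; apply/imfsetP; exists i.
pose g (i : 'I_n) := (svopp (svpos i), svpos i) : svertex n * svertex n.
have g_inj : injective g by move=> i j [].
rewrite -(card_imset _ g_inj); apply: eq_card => s; apply/idP/imsetP.
  rewrite inE => /andP[/[1!inE]/andP[]]; rewrite mem_link_signed.
  move=> /andP[lts sS] /andP[s1 s2] /eqP e.
  have es : s.2 = svpos s.2.2 by rewrite [LHS]surjective_pairing (negPf s2).
  exists s.2.2; last by rewrite /g -es -e -surjective_pairing.
  rewrite inE; case/orP: sS => [sS|/andP[]//].
  have := fsubsetP SB _ sS; rewrite inE mem_posD e eqxx andbF /=.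
  case/imfsetP => i _ /matrixP/(_ 0 s.2.2).
  have -> : pair_root s = 2 *: evec s.2.2.
    by rewrite -pair_root_long /pair_root e es.
  by rewrite !mxE !eqxx; case: eqP.
case=> i iT ->; have iS : evec i \in S by move: iT; rewrite !inE.
by rewrite inE inE mem_link_signed /crossing_zero /= eqxx iS orbT.
Qed.

End LinkCounting.

(** * Strongly orthogonal sets are pairwise disjoint *)

Section StronglyOrthogonal.
Context {n : nat}.
Implicit Types (S : {fset vec n}) (b : vec n).

Lemma mem_roots_of (pos : {fset vec n}) b :
  (b \in roots_of pos) = (b \in pos) || (- b \in pos).
Proof.
rewrite inE; congr orb; apply/imfsetP/idP => [[c cpos ->]|bpos].
  by rewrite opprK.
by exists (- b); rewrite ?opprK.
Qed.

Lemma mem_rootsC (u v : svertex n) :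
  u != v -> svec v - svec u \in roots_of (posC n).
Proof.
move=> uv; rewrite mem_roots_of opprB.
rewrite (mem_posC (u, v)) (mem_posC (v, u)) /=.
by case: ltgtP uv => // ->; rewrite eqxx.
Qed.

(** Orient the pairs of [x] and [y] so that their second vertices [v] and [v']
    share the common index.  Then either the difference (v' = v) or the sum
    (v' = -v) loses these vertices and is again a pair root; it is nonzero since
    [x <> y], and since [y = - x] is impossible for positive roots. *)
Lemma strongly_orthogonal_disjointC S : S `<=` posC n ->
  strongly_orthogonal (posC n) S -> pairwise_disjoint S.
Proof.
move=> /fsubsetP SC so x y xS yS nxy; apply/setP => i; rewrite in_setI in_set0.
apply/negP => /andP[xi yi].
have oriented b : b \in S -> i \in indices b ->
    exists (u v : svertex n), [/\ (u < v)%O, v.2 = i & b = svec v - svec u].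
  move=> bS; have /posC_upper[s [_ lts ->]] := SC b bS.
  case/indices_pair_root => ->; last by exists s.1, s.2.
  exists (svopp s.2), (svopp s.1); split; rewrite ?lt_svopp //.
  by rewrite -[LHS]pair_root_flip.
have [u [v [uv vi ex]]] := oriented x xS xi.
have [u' [v' [uv' vi' ey]]] := oriented y yS yi.
have [nsum ndiff] := so x y xS yS nxy.
case: (eqVneq v v') => [evv|nvv].
  case: (eqVneq u u') => [euu|nuu]; first by rewrite ex ey evv euu eqxx in nxy.
  case/negP: ndiff; rewrite ex ey evv opprB addrC addrA subrK.
  exact: mem_rootsC.
have evv : v' = svopp v.
  move: nvv; case: (v) (v') vi vi' => [e j] [e' j'] /= -> ->.
  by rewrite /svopp /=; case: e; case: e'; rewrite ?eqxx.
case: (eqVneq u (svopp u')) => [euu|nuu].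
  by move: uv'; rewrite evv -(svoppK u') -euu lt_svopp (lt_gtF uv).
case/negP: nsum; rewrite ex ey evv svec_opp addrACA subrr add0r addrC -(svec_opp u').
by apply: mem_rootsC.
Qed.

Lemma mem_rootsA (i j : 'I_n) :
  i != j -> evec j - evec i \in roots_of (posA n).
Proof.
move=> nij; rewrite mem_roots_of opprB; apply/orP.
case: (ltngtP i j) nij => [ij|ji|/val_inj->] nij; last by rewrite eqxx in nij.
- by left; apply/imfsetP; exists (i, j).
- by right; apply/imfsetP; exists (j, i).
Qed.

(** If the common index has the same sign in both roots then their difference is
    a root, and if it has opposite signs then their sum is. *)
Lemma strongly_orthogonal_disjointA S : S `<=` posA n ->
  strongly_orthogonal (posA n) S -> pairwise_disjoint S.
Proof.
move=> /fsubsetP SA so x y xS yS nxy; apply/setP => i; rewrite in_setI in_set0.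
apply/negP => /andP[].
have [nsum ndiff] := so x y xS yS nxy.
have /imfsetP[[k l] /= kl ex] := SA x xS.
have /imfsetP[[k' l'] /= kl' ey] := SA y yS.
rewrite inE /= in kl; rewrite inE /= in kl'.
rewrite ex ey -!pair_root_difference => /indices_pair_root /= h /indices_pair_root /= h'.
case: h h' => -> [] e.
- case/negP: ndiff; rewrite ex ey e opprB addrA subrK.
  apply: mem_rootsA; apply: contraNneq nxy => el.
  by rewrite ex ey e el.
- case/negP: nsum; rewrite ex ey e addrA subrK.
  apply: mem_rootsA; rewrite neq_ltn; apply/orP; left.
  by apply: ltn_trans kl' _; rewrite -e.
- case/negP: nsum; rewrite ex ey e addrC addrA subrK.
  apply: mem_rootsA; rewrite neq_ltn; apply/orP; left.
  by apply: ltn_trans kl _; rewrite e.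
- case/negP: ndiff; rewrite ex ey e opprB addrC addrA subrK.
  apply: mem_rootsA; apply: contraNneq nxy => el.
  by rewrite ex ey e el.
Qed.

End StronglyOrthogonal.

(** * The three length formulas *)

Section Lengths.
Context {n : nat}.
Implicit Types (S : {fset vec n}).

Lemma svec_svpos (i : 'I_n) : svec (svpos i) = evec i.
Proof. by rewrite /svec expr0 scale1r. Qed.

(** The vertices of type A are placed among the signed vertices as the positive ones. *)
Lemma length_A S : S `<=` posA n -> pairwise_disjoint S ->
  weylA (sigma S) /\
  (weyl_length (posA n) (sigma S) + #|linkA S| + 4 * right_pairs (linkA S)
     + 2 * crossings (linkA S)
   = 2 * #|linkA S| ^ 2 + 2 * fixed_under_arcs (linkA S))%N.
Proof.
move=> /fsubsetP SA disjS; set P := linkA S.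
pose f (i : 'I_n) := svec (svpos i).
have f_unit i : inner (f i) (f i) = 1 by exact: inner_svec_unit.
have f_inj i j : inner (f i) (f j) = 1 -> i = j by case/inner_svec_inj.
have oneS i := @disjoint_single n S disjS (svpos i).
have arc_lt s : s \in P -> (s.1 < s.2)%O by rewrite inE => /andP[].
have arc_root s : s \in P ->
    exists2 b, b \in S & exists2 a, a != 0 & b = a *: (f s.2 - f s.1).
  rewrite inE => /andP[_ sS]; exists (evec s.2 - evec s.1) => //.
  by exists 1; rewrite ?oner_eq0 // scale1r /f !svec_svpos.
have fixed_orth i b : fixed_point P i -> b \in S -> inner (f i) b = 0.
  move=> /forallP fi bS; have /imfsetP[p ltp eb] := SA b bS.
  have pP : p \in P by move: ltp; rewrite !inE -eb bS andbT.
  have /implyP/(_ pP)/andP[n1 n2] := fi p.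
  rewrite eb -!svec_svpos innerBr !inner_svec0 ?subrr //.
have [w [sw wE]] := sigma_swaps f_unit f_inj (disjoint_orth disjS) oneS
  arc_lt arc_root fixed_orth.
have linkP := link_pattern_of_roots f_unit f_inj oneS arc_lt arc_root.
split.
  exists w; apply/row_matrixP => i; rewrite rowK -svec_svpos -[svec _]wE.
  by rewrite /f svec_svpos -rowE.
rewrite -(card_inversions_swaps linkP sw).
rewrite (weyl_length_inversions (K := predT) (w := w) _ _ _ wE).
- by congr (_ + _ + _ + _)%N; apply: eq_card => x; rewrite !inE andbT.
- move=> b; apply: (iffP idP) => [/imfsetP[p ltp ->]|[p [_ ltp ->]]].
    by exists p; rewrite /f !svec_svpos; move: ltp; rewrite inE.
  by apply/imfsetP; exists p; rewrite ?inE // /f !svec_svpos.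
- move=> x y _ ltx _ lty; rewrite /f !svec_svpos; exact: difference_inj.
- move=> x _ _.
  apply/imfsetP/idP => [[p ltp e]|lt].
    have : (svpos (w x.2) < svpos (w x.1))%O.
      rewrite -(height_pair_root (svpos (w x.2), svpos (w x.1))).
      rewrite [pair_root _]e -pair_root_difference height_pair_root lt_sv.
      by move: ltp; rewrite inE.
    by rewrite lt_sv.
  by exists (w x.2, w x.1); rewrite // /f !svec_svpos.
Qed.

Lemma signed_mx_sigma S (w : {perm svertex n}) :
  (forall v, svec v *m sigma S = svec (w v)) -> sigma S = signed_mx w.
Proof.
move=> wE; apply/row_matrixP => i; rewrite rowK -[RHS]/(svec (w (svpos i))).
by rewrite -wE svec_svpos -rowE.
Qed.

(** On the signed vertices, [card_inversions_swaps] gives twice the length minus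
    the number of negated indices, which is m - 2a by [card_link_signed]. *)
Lemma length_C S : S `<=` posC n -> pairwise_disjoint S ->
  let P := link_signed S in
  weylC (sigma S) /\
  (weyl_length (posC n) (sigma S) + #|` S `&` difference_roots n|
     + crossings P + 2 * right_pairs P
   = #|P| ^ 2 + fixed_under_arcs P)%N.
Proof.
move=> /fsubsetP SC disjS P.
have SBC b : b \in S -> b \in posC n `|` posB n by move=> /SC bC; rewrite inE bC.
have [w [signed_w linkP sw wE]] := signed_realization SBC disjS.
split; first by exists w => //; apply: signed_mx_sigma.
have arith (m x a l i r c b : nat) : (m = x + 2 * a -> 2 * l = i + x ->
    i + m + 4 * r + 2 * c = 2 * m ^ 2 + 2 * b ->
    l + a + c + 2 * r = m ^ 2 + b)%N by lia.
have lenE := weyl_length_C signed_w wE; rewrite (card_negated linkP sw) in lenE.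
exact: arith (card_link_signed S) lenE (card_inversions_swaps linkP sw).
Qed.

(** The same count as in type C, with the number m - 2a of negated indices entering
    with the opposite sign. *)
Lemma length_D S : S `<=` posB n -> pairwise_disjoint S ->
  ~~ odd #|` S `&` short_roots n| ->
  let P := link_signed S in
  weylD (sigma S) /\
  (weyl_length (posD n) (sigma S) + #|P| + crossings P + 2 * right_pairs P
   = #|P| ^ 2 + #|` S `&` difference_roots n| + fixed_under_arcs P)%N.
Proof.
move=> SB disjS even P.
have SBC b : b \in S -> b \in posC n `|` posB n.
  by move=> /(fsubsetP SB) bB; rewrite inE bB orbT.
have [w [signed_w linkP sw wE]] := signed_realization SBC disjS.
have negE := card_negated linkP sw.
split.
  exists w; split=> //; last exact: signed_mx_sigma.
  by rewrite -/(negated w) negE odd_crossing_zero.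
have arith (m x a l i r c b : nat) : (m = x + 2 * a -> 2 * l + x = i ->
    i + m + 4 * r + 2 * c = 2 * m ^ 2 + 2 * b ->
    l + m + c + 2 * r = m ^ 2 + a + b)%N by lia.
have lenE := weyl_length_D signed_w wE; rewrite negE in lenE.
exact: arith (card_link_signed S) lenE (card_inversions_swaps linkP sw).
Qed.

End Lengths.

Theorem mainTheorem2 :
  [/\ (forall (n : nat) (S : {fset 'rV[rat]_n}),
        S `<=` posA n -> strongly_orthogonal (posA n) S ->
        let P := linkA S in
        let m : int := #|P| in
        let b : int := fixed_under_arcs P in
        let c : int := crossings P in
        let r : int := right_pairs P in
        weylA (sigma S) /\
        (weyl_length (posA n) (sigma S))%:Z
          = 2 * m ^+ 2 - m + 2 * b - 4 * r - 2 * c),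
      (forall (n : nat) (S : {fset 'rV[rat]_n}),
        S `<=` posC n -> strongly_orthogonal (posC n) S ->
        let P := link_signed S in
        let m : int := #|P| in
        let a : int := #|` S `&` difference_roots n| in
        let b : int := fixed_under_arcs P in
        let c : int := crossings P in
        let r : int := right_pairs P in
        weylC (sigma S) /\
        (weyl_length (posC n) (sigma S))%:Z = m ^+ 2 - a + b - c - 2 * r)
    & (forall (n d : nat) (S : {fset 'rV[rat]_n}),
        S `<=` posB n -> pairwise_disjoint S ->
        #|` S `&` short_roots n| = (2 * d)%N ->
        let P := link_signed S in
        let m : int := #|P| in
        let a : int := #|` S `&` difference_roots n| in
        let b : int := fixed_under_arcs P in
        let c : int := crossings P in
        let r : int := right_pairs P in
        weylD (sigma S) /\
        (weyl_length (posD n) (sigma S))%:Z = m ^+ 2 - m + a + b - c - 2 * r)].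
Proof.
split.
- move=> n S SA so P m b c r.
  have [wA lenA] := length_A SA (strongly_orthogonal_disjointA SA so).
  split=> //; rewrite -/P in lenA; rewrite /m /b /c /r; lia.
- move=> n S SC so P m a b c r.
  have [wC lenC] := length_C SC (strongly_orthogonal_disjointC SC so).
  split=> //; rewrite -/P in lenC; rewrite /m /a /b /c /r; lia.
- move=> n d S SB disjS short P m a b c r.
  have even : ~~ odd #|` S `&` short_roots n| by rewrite short oddM.
  have [wD lenD] := length_D SB disjS even.
  split=> //; rewrite -/P in lenD; rewrite /m /a /b /c /r; lia.
Qed.
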